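(* Over binary schemas, the query language $(\mathcal{ALC},\mathrm{AQ})$ has the same expressive power as unary connected simple MDDlog.
   Context: **Queries.** A schema $\mathbf{S}$ is a finite set of relation symbols with arities; it is binary if all its symbols have arity one (concept names) or two (role names). An instance $\mathfrak{D}$ over $\mathbf{S}$ is a finite set of facts $R(a_1,\dots,a_n)$, $R\in\mathbf{S}$, with $a_i$ from a fixed countably infinite set of constants; $\mathrm{adom}(\mathfrak{D})$ is the set of constants occurring in $\mathfrak{D}$. An $n$-ary query over $\mathbf{S}$ maps each $\mathbf{S}$-instance $\mathfrak{D}$ to a set $q(\mathfrak{D})\subseteq \mathrm{adom}(\mathfrak{D})^n$. Two queries over $\mathbf{S}$ are equivalent if they agree on all $\mathbf{S}$-instances. A query language is a set of queries. $\mathcal{Q}_2$ is at least as expressive as $\mathcal{Q}_1$ if every query of $\mathcal{Q}_1$ over some schema $\mathbf{S}$ is equivalent to a query of $\mathcal{Q}_2$ over $\mathbf{S}$; they have the same expressive power if this holds in both directions. AQ is the class of atomic queries $A(x)$ with $A$ a unary relation symbol. **Ontology-mediated queries.** An ontology language $\mathcal{L}$ is a set of first-order (FO) sentences; an $\mathcal{L}$-ontology $\mathcal{O}$ is a finite set of sentences of $\mathcal{L}$, and $\mathrm{sig}(\mathcal{O})$ is the set of its relation symbols. An ontology-mediated query is a triple $(\mathbf{S},\mathcal{O},q)$ with $\mathbf{S}$ a schema (the data schema), $\mathcal{O}$ an ontology and $q$ a query over $\mathbf{S}\cup\mathrm{sig}(\mathcal{O})$. A finite relational structure over a schema is a pair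 $(\mathrm{dom},\mathfrak{D})$ with $\mathrm{dom}$ a finite non-empty set and $\mathfrak{D}$ an instance over the schema with $\mathrm{adom}(\mathfrak{D})\subseteq\mathrm{dom}$. The triple defines the query over $\mathbf{S}$ that maps $\mathfrak{D}$ to the set of certain answers: all $\mathbf{a}\in\mathrm{adom}(\mathfrak{D})^n$ such that $\mathbf{a}\in q(\mathfrak{D}')$ for every finite relational structure $(\mathrm{dom},\mathfrak{D}')$ over $\mathbf{S}\cup\mathrm{sig}(\mathcal{O})$ that satisfies $\mathcal{O}$ and has $\mathfrak{D}\subseteq\mathfrak{D}'$. $(\mathcal{L},\mathcal{Q})$ denotes the query language of all queries defined by ontology-mediated queries $(\mathbf{S},\mathcal{O},q)$ with $\mathcal{O}$ an $\mathcal{L}$-ontology and $q\in\mathcal{Q}$. **$\mathcal{ALC}$.** $\mathcal{ALC}$-concepts: $C,D::=A\mid\top\mid\bot\mid\neg C\mid C\sqcap D\mid C\sqcup D\mid\exists R.C\mid\forall R.C$ with $A$ a concept name, $R$ a role name. They translate to FO formulas with one free variable: $A^*(x)=A(x)$; $\top,\bot$ and Booleans as expected; $(\exists R.C)^*(x)=\exists y(R(x,y)\wedge C^*(y))$; $(\forall R.C)^*(x)=\forall y(R(x,y)\to C^*(y))$. An $\mathcal{ALC}$-ontology is a finite set of concept inclusions $C\sqsubseteq D$, read as $\forall x(C^*(x)\to D^*(x))$. **MDDlog.** A disjunctive datalog rule has the form $S_1(\mathbf{x}_1)\vee\cdots\vee S_m(\mathbf{x}_m)\leftarrow R_1(\mathbf{y}_1)\wedge\cdots\wedge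 R_n(\mathbf{y}_n)$, $m\ge 0$, $n>0$, where every head variable occurs in the body (empty head: $\bot$). A disjunctive datalog (DDlog) program $\Pi$ is a finite set of such rules with a selected predicate $\mathsf{goal}$ that does not occur in rule bodies and occurs in heads only in rules $\mathsf{goal}(\mathbf{x})\leftarrow R_1(\mathbf{x}_1)\wedge\cdots\wedge R_n(\mathbf{x}_n)$. Relation symbols occurring in some rule head are IDB predicates, the others EDB predicates. $\Pi$ defines the query $q_\Pi$ over the schema of its EDB predicates: $q_\Pi(\mathfrak{D})$ is the set of $\mathbf{a}\in\mathrm{adom}(\mathfrak{D})^n$ ($n$ the arity of $\mathsf{goal}$) with $\mathsf{goal}(\mathbf{a})\in\mathfrak{D}'$ for all instances $\mathfrak{D}'\supseteq\mathfrak{D}$ over the IDB and EDB predicates satisfying all rules of $\Pi$. $\Pi$ is an MDDlog program if all IDB predicates except possibly $\mathsf{goal}$ are unary. It is unary if $\mathsf{goal}$ is unary. A rule is connected if the undirected graph whose nodes are the variables of the rule and whose edges join two variables co-occurring in a body atom is connected; a program is connected if all its rules are. An MDDlog program is simple if each rule contains at most one atom $R(\mathbf{x})$ with $R$ an EDB relation and, in this atom, every variable occurs at most once. ''Unary connected simple MDDlog'' is the language of queries defined by MDDlog programs with all three properties. *)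

(* Defs.v *)
From Stdlib Require List.
From mathcomp Require Import all_boot finmap.

Set Implicit Arguments.
Unset Strict Implicit.
Unset Printing Implicit Defensive.

Local Open Scope fset_scope.

(** * Schemas, instances, queries *)

Definition const := nat.

(* A relation symbol is a pair (name, arity): there are countably many symbols
   of each arity, and symbols of different arities are distinct. *)
Definition relsym := (nat * nat)%type.
Definition arity (R : relsym) : nat := R.2.

Definition concept_sym (A : nat) : relsym := (A, 1).
Definition role_sym (R : nat) : relsym := (R, 2).

Definition schema := {fset relsym}.

Definition binary (S : schema) : Prop :=
  forall R, R \in S -> arity R = 1 \/ arity R = 2.

Definition fact := {R : relsym & (arity R).-tuple const}.
Definition mkfact (R : relsym) (a : (arity R).-tuple const) : fact :=
  existT (fun R : relsym => (arity R).-tuple const) R a.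

Record instance (S : schema) := Instance {
  facts :> {fset fact};
  facts_over : forall f, f \in facts -> tag f \in S
}.

Definition adom (D : {fset fact}) : {fset const} :=
  \bigcup_(f <- D) [fset c in tval (tagged f)].

Record query (S : schema) (n : nat) := Query {
  ans :> instance S -> n.-tuple const -> Prop;
  ans_adom : forall D a, ans D a -> {subset a <= adom D}
}.

Definition equivalent (S : schema) (n : nat) (q1 q2 : query S n) : Prop :=
  forall (D : instance S) (a : n.-tuple const), q1 D a <-> q2 D a.

Definition query_language := forall (S : schema) (n : nat), query S n -> Prop.

Definition at_least_as_expressive_over (P : schema -> Prop)
    (Q2 Q1 : query_language) : Prop :=
  forall (S : schema) (n : nat) (q1 : query S n), P S -> Q1 S n q1 ->
  exists q2 : query S n, Q2 S n q2 /\ equivalent q1 q2.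

Definition same_expressive_power_over (P : schema -> Prop)
    (Q1 Q2 : query_language) : Prop :=
  at_least_as_expressive_over P Q1 Q2 /\ at_least_as_expressive_over P Q2 Q1.

Definition atomic_ans (S : schema) (A : nat) (D : instance S)
    (a : 1.-tuple const) : Prop :=
  @mkfact (concept_sym A) a \in facts D.

Lemma atomic_ans_adom S A (D : instance S) a :
  atomic_ans A D a -> {subset a <= adom D}.
Proof.
move=> Da c ca; apply/bigfcupP; exists (@mkfact (concept_sym A) a).
  by rewrite andbT.
by rewrite inE.
Qed.

Definition atomic_query (S : schema) (A : nat) : query S 1 :=
  Query (@atomic_ans_adom S A).

(* [A(x)] is a query over [S] only if [A] belongs to [S]. *)
Inductive AQ : query_language :=
| AQ_intro (S : schema) (A : nat) :
    concept_sym A \in S -> AQ (atomic_query S A).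

(** * First-order logic over finite relational structures *)

(* [formula V] is the type of formulas with free variables among [V]; a
   quantifier binds the variable [None] of its scope.  A sentence is a formula
   without free variables. *)
Inductive formula (V : Type) : Type :=
| FTrue
| FFalse
| FEq of V & V
| FRel (R : relsym) of (arity R).-tuple V
| FNot of formula V
| FAnd of formula V & formula V
| FOr of formula V & formula V
| FImp of formula V & formula V
| FEx of formula (option V)
| FAll of formula (option V).

Arguments FTrue {V}.
Arguments FFalse {V}.
Arguments FRel {V} R _.

Definition sentence := formula void.

Fixpoint sig_formula V (phi : formula V) : {fset relsym} :=
  match phi with
  | FTrue | FFalse | FEq _ _ => fset0
  | FRel R _ => [fset R]
  | FNot p => sig_formula p
  | FAnd p q | FOr p q | FImp p q => sig_formula p `|` sig_formula q
  | FEx p | FAll p => sig_formula p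
  end.

Record structure (S : schema) := Structure {
  dom : {fset const};
  struct_inst :> instance S;
  dom_neq0 : dom != fset0;
  adom_sub_dom : adom struct_inst `<=` dom
}.

Definition extend V (e : V -> const) (c : const) (o : option V) : const :=
  if o is Some v then e v else c.

Fixpoint holds (S : schema) (M : structure S) V (e : V -> const)
    (phi : formula V) : Prop :=
  match phi with
  | FTrue => True
  | FFalse => False
  | FEq x y => e x = e y
  | FRel R xs => mkfact [tuple of map e xs] \in facts M
  | FNot p => ~ holds M e p
  | FAnd p q => holds M e p /\ holds M e q
  | FOr p q => holds M e p \/ holds M e q
  | FImp p q => holds M e p -> holds M e q
  | FEx p => exists c, c \in dom M /\ holds M (extend e c) p
  | FAll p => forall c, c \in dom M -> holds M (extend e c) p
  end.

(** * Ontology-mediated queries *)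

Definition ontology_language := sentence -> Prop.
Definition ontology := seq sentence.

Definition is_ontology (L : ontology_language) (O : ontology) : Prop :=
  List.Forall L O.

Definition sig (O : ontology) : schema :=
  \bigcup_(phi <- O) sig_formula phi.

Definition satisfies (S : schema) (M : structure S) (O : ontology) : Prop :=
  List.Forall (holds M (of_void const)) O.

Definition certain_ans (S : schema) (O : ontology) (n : nat)
    (q : query (S `|` sig O) n) (D : instance S) (a : n.-tuple const) : Prop :=
  {subset a <= adom D} /\
  forall M : structure (S `|` sig O),
    satisfies M O -> facts D `<=` facts M -> q M a.

Lemma certain_ans_adom S O n (q : query (S `|` sig O) n) (D : instance S) a :
  certain_ans q D a -> {subset a <= adom D}.
Proof. by case. Qed.

Definition omq (S : schema) (O : ontology) (n : nat)
    (q : query (S `|` sig O) n) : query S n :=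
  Query (@certain_ans_adom S O n q).

Inductive OMQ (L : ontology_language) (Q : query_language) : query_language :=
| OMQ_intro (S : schema) (O : ontology) (n : nat)
    (q : query (S `|` sig O) n) :
    is_ontology L O -> Q (S `|` sig O) n q -> OMQ L Q (omq q).

(** * ALC *)

Inductive concept : Type :=
| CName of nat
| CTop
| CBot
| CNot of concept
| CAnd of concept & concept
| COr of concept & concept
| CEx of nat & concept
| CAll of nat & concept.

Fixpoint fo_concept (C : concept) V (x : V) : formula V :=
  match C with
  | CName A => FRel (concept_sym A) [tuple x]
  | CTop => FTrue
  | CBot => FFalse
  | CNot C => FNot (fo_concept C x)
  | CAnd C D => FAnd (fo_concept C x) (fo_concept D x)
  | COr C D => FOr (fo_concept C x) (fo_concept D x)
  | CEx R C => FEx (FAnd (FRel (role_sym R) [tuple Some x; None])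
                         (fo_concept C None))
  | CAll R C => FAll (FImp (FRel (role_sym R) [tuple Some x; None])
                           (fo_concept C None))
  end.

Definition inclusion (C D : concept) : sentence :=
  FAll (FImp (fo_concept C None) (fo_concept D None)).

Definition ALC : ontology_language :=
  fun phi => exists C D : concept, phi = inclusion C D.

(** * Disjunctive datalog *)

Definition var := nat.

Definition atom := {R : relsym & (arity R).-tuple var}.

Definition atoms_vars (s : seq atom) : seq var :=
  flatten [seq tval (tagged A) | A <- s].

(* [head] is read disjunctively (the empty head is falsity), [body]
   conjunctively. *)
Record rule := Rule {
  head : seq atom;
  body : seq atom;
  body_nonempty : body != [::];
  head_safe : {subset atoms_vars head <= atoms_vars body}
}.

Definition rule_vars (r : rule) : seq var :=
  atoms_vars (head r) ++ atoms_vars (body r).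

Record program := Program {
  rules : seq rule;
  goal : relsym;
  goal_notin_body : List.Forall
    (fun r => goal \notin [seq tag A | A <- body r]) rules;
  goal_head : List.Forall
    (fun r => goal \in [seq tag A | A <- head r] -> size (head r) = 1) rules
}.

Definition idb (Pi : program) : schema :=
  [fset R in flatten [seq [seq tag A | A <- head r] | r <- rules Pi]].

(* A goal that occurs in no rule is neither in [idb] nor in [edb]. *)
Definition edb (Pi : program) : schema :=
  [fset R in flatten [seq [seq tag A | A <- body r] | r <- rules Pi]]
    `\` idb Pi.

Definition ground (h : var -> const) (A : atom) : fact :=
  mkfact [tuple of map h (tagged A)].

Definition rule_holds (D : {fset fact}) (r : rule) : Prop :=
  forall h : var -> const,
    (forall A, A \in body r -> ground h A \in D) ->
    exists2 A, A \in head r & ground h A \in D.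

Definition ddlog_ans (Pi : program) (D : instance (edb Pi))
    (a : (arity (goal Pi)).-tuple const) : Prop :=
  {subset a <= adom D} /\
  forall D' : instance (idb Pi `|` edb Pi),
    facts D `<=` facts D' -> List.Forall (rule_holds D') (rules Pi) ->
    mkfact a \in facts D'.

Lemma ddlog_ans_adom Pi (D : instance (edb Pi)) a :
  ddlog_ans D a -> {subset a <= adom D}.
Proof. by case. Qed.

Definition ddlog_query (Pi : program) : query (edb Pi) (arity (goal Pi)) :=
  Query (@ddlog_ans_adom Pi).

Inductive DDlog (P : program -> Prop) : query_language :=
| DDlog_intro (Pi : program) : P Pi -> DDlog P (ddlog_query Pi).

Definition monadic (Pi : program) : Prop :=
  forall R, R \in idb Pi -> R != goal Pi -> arity R = 1.

Definition unary (Pi : program) : Prop := arity (goal Pi) = 1.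

Definition cooccur (r : rule) : rel var :=
  fun x y => has (fun A : atom => (x \in tval (tagged A)) &&
                                  (y \in tval (tagged A))) (body r).

Definition connected_rule (r : rule) : Prop :=
  forall x y, x \in rule_vars r -> y \in rule_vars r ->
  exists2 p : seq var, path (cooccur r) x p & last x p = y.

Definition connected (Pi : program) : Prop :=
  List.Forall connected_rule (rules Pi).

(* EDB atoms can only occur in rule bodies. *)
Definition simple_rule (E : schema) (r : rule) : Prop :=
  let edb_atoms := [seq A <- body r | tag A \in E] in
  size edb_atoms <= 1 /\
  forall A, A \in edb_atoms -> uniq (tval (tagged A)).

Definition simple (Pi : program) : Prop :=
  List.Forall (simple_rule (edb Pi)) (rules Pi).

Definition UCS_MDDlog : query_language :=
  DDlog (fun Pi => [/\ monadic Pi, unary Pi, connected Pi & simple Pi]).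

(* Main.v *)
(** From MDDlog to ALC: in a connected simple rule over a binary schema the body
    is either about one variable [x], or contains one role atom [R(x,y)] and
    otherwise unary atoms on [x] and [y]. In the second case the rule says that
    [B_x] and [EX R.(B_y and not H_y)] imply [H_x], where [B_z] is the
    conjunction of the unary body atoms on [z] and [H_z] the disjunction of the
    head atoms on [z].

    From ALC to MDDlog: up to agreement on a finite set of concepts, there are
    finitely many pointed finite models of the ontology. Their types [i] serve
    as IDB predicates [P_i]. The program guesses a type for every constant and
    rejects the labellings that violate a fact of the data; type [j] may follow
    type [i] along [R] if no relevant [EX R.C] or [ALL R.C] forbids it. If a
    labelling survives, a countermodel to the OMQ has as elements the labelled
    constants and one fresh element for each type, with all concept facts that
    the labels require and all role facts that they permit. *)

From Stdlib Require List.
From mathcomp Require Import all_boot finmap.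
From mathcomp Require Import boolp.
Require Import Defs.

Set Implicit Arguments.
Unset Strict Implicit.
Unset Printing Implicit Defensive.

Local Open Scope fset_scope.

(** * Facts and instances *)

(** The tuple of a fact has a type that depends on its symbol. Flattened to a list, facts are
    compared without transport along equations between arities. *)
Definition flat (f : fact) : relsym * seq const := (tag f, tval (tagged f)).

Lemma flat_inj : injective flat.
Proof.
move=> [R a] [R' a'] [/= eR]; case: _ / eR a' => a' /= eq_a.
by congr existT; apply: val_inj.
Qed.

Definition has_fact (D : {fset fact}) (R : relsym) (s : seq const) : bool :=
  (R, s) \in map flat D.

Lemma mkfact_in D R (a : (arity R).-tuple const) :
  (mkfact a \in D) = has_fact D R a.
Proof. by rewrite -(mem_map flat_inj). Qed.

Lemma has_factP (D : {fset fact}) R s :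
  reflect (exists2 f, f \in D & flat f = (R, s)) (has_fact D R s).
Proof. by apply: (iffP mapP) => -[f Df]; exists f. Qed.

Lemma in_has_fact (D : {fset fact}) f :
  (f \in D) = has_fact D (tag f) (tagged f).
Proof. by rewrite -(mem_map flat_inj). Qed.

Lemma has_fact_size D R s : has_fact D R s -> size s = arity R.
Proof. by case/has_factP => -[R' a] _ [<- <-]; rewrite size_tuple. Qed.

Lemma has_fact_over S (D : instance S) R s : has_fact D R s -> R \in S.
Proof. by case/has_factP => f /facts_over Sf [<-]. Qed.

Lemma has_fact_subP (D D' : {fset fact}) :
  (forall R s, has_fact D R s -> has_fact D' R s) <-> D `<=` D'.
Proof.
split=> [sub | /fsubsetP sub R s /has_factP[f /sub D'f Ef]].
  by apply/fsubsetP => f; rewrite !in_has_fact; apply: sub.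
by apply/has_factP; exists f.
Qed.

Lemma adomP (D : {fset fact}) c :
  reflect (exists R s, has_fact D R s /\ c \in s) (c \in adom D).
Proof.
apply: (iffP (bigfcupP _ _ _ _)) => [[f /andP[Df _]] | [R [s [/has_factP[f Df Ef] sc]]]].
  by rewrite inE /= => fc; exists (tag f), (tagged f); rewrite -in_has_fact.
by exists f; rewrite ?andbT //= inE /=; case: Ef sc => _ <-.
Qed.

Section InstOf.
Variables (S : schema) (d : {fset const}) (P : relsym -> seq const -> Prop).

(** A finite universe of facts, from which [inst_facts] separates those with an arbitrary property
    [P], decided classically. *)
Definition all_facts : {fset fact} :=
  \bigcup_(R <- S) [fset mkfact (map_tuple val t) | t in {: (arity R).-tuple d}].

Definition inst_facts : {fset fact} :=
  [fset f in all_facts | `[< P (tag f) (tagged f) >]].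

Lemma all_factsP R s :
  reflect [/\ R \in S, size s = arity R & {subset s <= d}]
          (has_fact all_facts R s).
Proof.
apply: (iffP (has_factP _ _ _)) => [[f /bigfcupP[R' /andP[SR' _]]] | ].
  case/imfsetP => t /= _ -> [<- <-]; rewrite size_map size_tuple; split=> //.
  by move=> c /mapP[x _ ->]; apply: valP.
case=> SR sz_s sub_s.
(* The list [s] is lifted to a tuple over the finite type [d]; since all its entries lie in [d],
   [pmap] drops none of them. *)
have sz_t : size (pmap (insub : const -> option d) s) == arity R.
  rewrite size_pmap_sub -sz_s -all_count.
  by apply/allP => c /sub_s.
exists (mkfact (map_tuple val (Tuple sz_t))).
  apply/bigfcupP; exists R; first by rewrite SR.
  by apply/imfsetP; exists (Tuple sz_t).
congr pair; rewrite /= (pmap_filter (insubK _)).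
by apply/all_filterP/allP => c /sub_s dc; rewrite insubT.
Qed.

Lemma inst_factsP R s :
  has_fact inst_facts R s <->
  [/\ R \in S, size s = arity R, {subset s <= d} & P R s].
Proof.
split=> [/has_factP[f]|[SR sz_s sub_s Ps]].
  rewrite !inE => /andP[]; rewrite in_has_fact => /all_factsP[? ? ?] /asboolP.
  by move=> Pf [<- <-].
have /has_factP[f Sf Ef]: has_fact all_facts R s by apply/all_factsP.
apply/has_factP; exists f => //; rewrite !inE Sf /=.
by apply/asboolP; move: Ps; case: Ef => <- <-.
Qed.

Lemma inst_facts_over f : f \in inst_facts -> tag f \in S.
Proof. by rewrite in_has_fact => /inst_factsP[]. Qed.

Definition inst_of : instance S := Instance inst_facts_over.

Lemma adom_inst_of : adom inst_of `<=` d.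
Proof.
by apply/fsubsetP => c /adomP[R [s [/inst_factsP[_ _ sub_s _] /sub_s]]].
Qed.

End InstOf.

(** * Semantics of concepts *)

(** The role quantifiers need no domain guard: both ends of a role fact lie in the active domain,
    hence in [dom M]. *)
Fixpoint csat S (M : structure S) (C : concept) (c : const) : Prop :=
  match C with
  | CName A => has_fact M (concept_sym A) [:: c]
  | CTop => True
  | CBot => False
  | CNot C => ~ csat M C c
  | CAnd C D => csat M C c /\ csat M D c
  | COr C D => csat M C c \/ csat M D c
  | CEx R C => exists2 d, has_fact M (role_sym R) [:: c; d] & csat M C d
  | CAll R C => forall d, has_fact M (role_sym R) [:: c; d] -> csat M C d
  end.

Lemma has_fact_dom S (M : structure S) R s c :
  has_fact M R s -> c \in s -> c \in dom M.
Proof.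
by move=> Ms sc; apply: (fsubsetP (adom_sub_dom M)); apply/adomP; exists R, s.
Qed.

Lemma holds_concept S (M : structure S) C V (e : V -> const) x :
  holds M e (fo_concept C x) <-> csat M C (e x).
Proof.
elim: C V e x => [A|||C IH|C IHC D IHD|C IHC D IHD|R C IH|R C IH] V e x //=.
- by rewrite mkfact_in.
- by rewrite IH.
- by rewrite IHC IHD.
- by rewrite IHC IHD.
- split=> [[c [_ [Rc /IH Cc]]]|[c Rc Cc]].
    by exists c => //; move: Rc; rewrite mkfact_in.
  exists c; split; first by apply: (has_fact_dom Rc); rewrite !inE eqxx orbT.
  by split; [rewrite mkfact_in|apply/IH].
- split=> sC c.
    move=> Rc; apply/(IH _ (extend e c) None)/sC; last by rewrite mkfact_in.
    by apply: (has_fact_dom Rc); rewrite !inE eqxx orbT.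
  by move=> _; rewrite mkfact_in => Rc; apply/IH/sC.
Qed.

Lemma holds_inclusion S (M : structure S) C D (e : void -> const) :
  holds M e (inclusion C D) <->
  forall c, c \in dom M -> csat M C c -> csat M D c.
Proof.
split=> sub c dc /=.
  by move=> /(holds_concept _ _ (extend e c) None)/(sub c dc)/holds_concept.
by move=> /holds_concept/(sub c dc) ?; apply/holds_concept.
Qed.

(** * Lists: membership and [List.Forall] *)

Lemma mem_flatten_map (T : Type) (U : eqType) (f : T -> seq U) s u :
  u \in flatten (map f s) <-> exists2 x, List.In x s & u \in f x.
Proof.
elim: s => [|x s IHs] /=; first by split=> // -[].
rewrite mem_cat; split=> [/orP[fu|/IHs[y sy fu]]|[y [<- ->//|sy fu]]].
- by exists x; [left|].
- by exists y; [right|].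
- by apply/orP; right; apply/IHs; exists y.
Qed.

Lemma Forall_mapP (T : eqType) (U : Type) (f : T -> U) (P : U -> Prop) s :
  List.Forall P (map f s) <-> forall x, x \in s -> P (f x).
Proof.
elim: s => [|x s IHs] /=; first by split=> // _; constructor.
split=> [/List.Forall_cons_iff[Px /IHs Ps] y|Ps].
  by rewrite inE => /predU1P[->|/Ps].
constructor; first by apply: Ps; rewrite mem_head.
by apply/IHs => y sy; apply: Ps; rewrite inE sy orbT.
Qed.

Lemma in_List (T : eqType) (x : T) s : x \in s -> List.In x s.
Proof.
by elim: s => //= y s IHs; rewrite inE => /predU1P[->|/IHs]; [left|right].
Qed.

Lemma In_catl (T : Type) (x : T) s t : List.In x s -> List.In x (s ++ t).
Proof. by elim: s => //= y s IHs [->|/IHs]; [left|right]. Qed.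

Lemma In_catr (T : Type) (x : T) s t : List.In x t -> List.In x (s ++ t).
Proof. by elim: s => //= y s IHs tx; right; apply: IHs. Qed.

Lemma In_map (T U : Type) (f : T -> U) x s : List.In x s -> List.In (f x) (map f s).
Proof. by elim: s => //= y s IHs [->|/IHs]; [left|right]. Qed.

Lemma Forall_cat (T : Type) (P : T -> Prop) s t :
  List.Forall P (s ++ t) <-> List.Forall P s /\ List.Forall P t.
Proof.
elim: s => [|x s IHs] /=; first by split=> [Pt|[]//]; split.
by rewrite !List.Forall_cons_iff IHs and_assoc.
Qed.

(** * From MDDlog to ALC *)

Lemma sig_formula_sub_sig phi (O : ontology) :
  List.In phi O -> sig_formula phi `<=` sig O.
Proof.
rewrite /sig; elim: O => [|psi O IHO] //=; rewrite big_cons.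
by case=> [->|/IHO subO]; rewrite ?fsubsetUl // fsubsetU // subO orbT.
Qed.

(** The arity is a variable with an equation [n = 1] because the arity of a program's query,
    [arity (goal Pi)], is only provably equal to 1. *)
Lemma OMQ_AQ_intro (S : schema) n (q : query S n) (O : ontology) A :
  n = 1 -> is_ontology ALC O -> concept_sym A \in S `|` sig O ->
  (forall (D : instance S) a, q D a <-> {subset a <= adom D} /\
     forall M : structure (S `|` sig O), satisfies M O -> facts D `<=` facts M ->
     has_fact M (concept_sym A) a) ->
  exists q2 : query S n, OMQ ALC AQ q2 /\ equivalent q q2.
Proof.
move=> n1; subst n => ALCO SA qE; exists (omq (atomic_query (S `|` sig O) A)).
split; first exact/OMQ_intro/AQ_intro.
move=> D a; rewrite qE; split=> -[sub_a cert]; split=> // M MO DM.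
  by have := cert M MO DM; rewrite -mkfact_in.
by rewrite -mkfact_in; apply: cert.
Qed.

Lemma rule_holdsE (D : {fset fact}) r :
  rule_holds D r <-> forall h : var -> const,
    (forall A, A \in body r -> has_fact D (tag A) (map h (tagged A))) ->
    exists2 A, A \in head r & has_fact D (tag A) (map h (tagged A)).
Proof.
split=> hold h bD.
  case: (hold h) => [A /bD|A hA]; rewrite mkfact_in //.
  by exists A.
case: (hold h) => [A /bD|A hA DA]; rewrite ?mkfact_in //.
by exists A => //; rewrite mkfact_in.
Qed.

Lemma tag_concept (A : atom) x :
  tval (tagged A) = [:: x] -> tag A = concept_sym (tag A).1.
Proof.
by case: A => -[n k] a /= Ea; move: (size_tuple a); rewrite Ea /arity /= => <-.
Qed.

Definition names_at (s : seq atom) (x : var) : seq nat :=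
  [seq (tag A).1 | A <- s & tval (tagged A) == [:: x]].

Definition conj_names := foldr (fun A => CAnd (CName A)) CTop.
Definition disj_names := foldr (fun A => COr (CName A)) CBot.

Lemma csat_conj_names S (M : structure S) l c :
  csat M (conj_names l) c <->
  forall A, A \in l -> has_fact M (concept_sym A) [:: c].
Proof.
elim: l => [|A l IHl] //=; rewrite IHl; split=> [[MA Ml] B|Ml].
  by rewrite inE => /predU1P[->|/Ml].
by split=> [|B lB]; apply: Ml; rewrite inE ?eqxx ?lB ?orbT.
Qed.

Lemma csat_disj_names S (M : structure S) l c :
  csat M (disj_names l) c <->
  exists2 A, A \in l & has_fact M (concept_sym A) [:: c].
Proof.
elim: l => [|A l IHl] /=; first by split=> // -[].
rewrite IHl; split=> [[MA|[B lB MB]]|[B]].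
- by exists A; rewrite ?mem_head.
- by exists B; rewrite // inE lB orbT.
- by rewrite inE => /predU1P[->|lB] MB; [left|right; exists B].
Qed.

Definition conj_at s x := conj_names (names_at s x).
Definition disj_at s x := disj_names (names_at s x).

Lemma csat_conj_at S (M : structure S) s x c :
  csat M (conj_at s x) c <->
  forall A, A \in s -> tval (tagged A) = [:: x] -> has_fact M (tag A) [:: c].
Proof.
rewrite csat_conj_names; split=> [Ms A sA Ax|Ms n].
  by rewrite (tag_concept Ax); apply/Ms/map_f; rewrite mem_filter Ax eqxx.
case/mapP=> A; rewrite mem_filter => /andP[/eqP Ax sA] ->.
by rewrite -(tag_concept Ax); apply: Ms.
Qed.

Lemma csat_disj_at S (M : structure S) s x c :
  csat M (disj_at s x) c <-> exists A,
    [/\ A \in s, tval (tagged A) = [:: x] & has_fact M (tag A) [:: c]].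
Proof.
rewrite csat_disj_names; split=> [[n /mapP[A]]|[A [sA Ax MA]]].
  rewrite mem_filter => /andP[/eqP Ax sA] -> MA.
  by exists A; split; rewrite // (tag_concept Ax).
exists (tag A).1; last by rewrite -(tag_concept Ax).
by apply/map_f; rewrite mem_filter Ax eqxx.
Qed.

Lemma path_last_inv (T : eqType) (e : rel T) (P : T -> Prop) x p :
  (forall y z, e y z -> P y -> P z) -> path e x p -> P x -> P (last x p).
Proof.
move=> eP; elim: p x => [|y p IHp] x //= /andP[exy py] Px.
by apply: IHp py _; apply: eP exy Px.
Qed.

Lemma tagged_unary (A : atom) x : arity (tag A) = 1 -> x \in tval (tagged A) ->
  tval (tagged A) = [:: x].
Proof.
move=> A1; have: size (tval (tagged A)) = 1 by rewrite size_tuple.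
by case: (tval (tagged A)) => [|y []] //= _; rewrite inE => /eqP ->.
Qed.

(** * Variables of connected rules *)

Section RuleShape.
Variables (r : rule).
Hypothesis conn_r : connected_rule r.
Hypothesis head1 : forall A, A \in head r -> arity (tag A) = 1.

Lemma mem_rule_vars A z :
  A \in head r ++ body r -> z \in tval (tagged A) -> z \in rule_vars r.
Proof.
rewrite /rule_vars /atoms_vars mem_cat => rA Az.
rewrite mem_cat; apply/orP; case/orP: rA => rA; [left|right];
  by apply/flatten_mapP; exists A.
Qed.

(** If all body atoms are unary, co-occurring variables are equal, so a path of co-occurrences never
    leaves its first variable. The nonempty body provides that variable. *)
Lemma unary_rule_shape :
  (forall A, A \in body r -> arity (tag A) = 1) ->
  exists x, forall A, A \in head r ++ body r -> tval (tagged A) = [:: x].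
Proof.
move=> body1; have /hasP[A0 bA0 _]: has predT (body r).
  by rewrite has_predT lt0n size_eq0 body_nonempty.
have: size (tval (tagged A0)) = 1 by rewrite size_tuple body1.
case E0: (tval (tagged A0)) => [|x []] // _; exists x => A rA.
have A1 : arity (tag A) = 1.
  by move: rA; rewrite mem_cat => /orP[/head1|/body1].
have: size (tval (tagged A)) = 1 by rewrite size_tuple.
case E: (tval (tagged A)) => [|y []] // _; congr [:: _]; symmetry.
have rx : x \in rule_vars r.
  by apply: (@mem_rule_vars A0); rewrite ?mem_cat ?bA0 ?orbT ?E0 ?mem_head.
have ry : y \in rule_vars r by apply: (mem_rule_vars rA); rewrite E mem_head.
have [p xp <-] := conn_r rx ry.
apply: (path_last_inv (P := fun z => x = z)) xp _ => // u v.
case/hasP=> B bB /andP[Bu Bv] ->.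
by move: Bv; rewrite (tagged_unary (body1 _ bB) Bu) inE => /eqP.
Qed.

(** Only [A0] links distinct variables, so a path of co-occurrences that starts at [x] stays within
    the two variables of [A0]. *)
Lemma binary_rule_shape A0 :
  A0 \in body r -> arity (tag A0) = 2 -> uniq (tagged A0) ->
  (forall A, A \in body r -> arity (tag A) = 1 \/ A = A0) ->
  exists R x y, [/\ x != y, flat A0 = (role_sym R, [:: x; y]) &
    forall A, A \in head r ++ body r ->
      [\/ A = A0 /\ A \in body r, tval (tagged A) = [:: x]
        | tval (tagged A) = [:: y]]].
Proof.
move=> bA0 ar2 unA0 body12; exists (tag A0).1.
have: size (tval (tagged A0)) = 2 by rewrite size_tuple.
move: unA0.
case E0: (tval (tagged A0)) => [|x [|y []]] //=.
rewrite inE andbT => xNy _; exists x, y; split=> //.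
  by rewrite /flat E0; congr pair; move: ar2; rewrite /arity; case: (tag A0) => m k /= ->.
have in_xy z : z \in rule_vars r -> z \in [:: x; y].
  move=> rz; have [|p xp <-] := @conn_r x z _ rz.
    by apply: (@mem_rule_vars A0); rewrite ?mem_cat ?bA0 ?orbT ?E0 ?mem_head.
  apply: (path_last_inv (P := fun z => z \in [:: x; y])) xp _; last first.
    by rewrite mem_head.
  move=> u v /hasP[B bB /andP[Bu Bv]] xyu.
  have [B1|EB] := body12 _ bB; last by rewrite EB E0 in Bv.
  by move: Bv; rewrite (tagged_unary B1 Bu) mem_seq1 => /eqP->.
move=> A rA.
have [A1|[-> bA]] : arity (tag A) = 1 \/ A = A0 /\ A \in body r.
- move: (rA); rewrite mem_cat => /orP[/head1|bA]; first by left.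
  by case: (body12 _ bA) => [|->]; [left|right].
- have: size (tval (tagged A)) = 1 by rewrite size_tuple.
  case E: (tval (tagged A)) => [|z []] // _.
  have: z \in [:: x; y] by apply/in_xy/(mem_rule_vars rA); rewrite E mem_head.
  by rewrite !inE => /orP[] /eqP->; [constructor 2|constructor 3].
- by constructor 1.
Qed.

End RuleShape.

Lemma unary_rule_inclusion r x :
  (forall A, A \in head r ++ body r -> tval (tagged A) = [:: x]) ->
  forall S (M : structure S) (e : void -> const),
  holds M e (inclusion (conj_at (body r) x) (disj_at (head r) x)) <->
  rule_holds M r.
Proof.
move=> rx S M e; rewrite holds_inclusion rule_holdsE.
have hx A : A \in head r -> tval (tagged A) = [:: x].
  by move=> hA; apply: rx; rewrite mem_cat hA.
have bx A : A \in body r -> tval (tagged A) = [:: x].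
  by move=> bA; apply: rx; rewrite mem_cat bA orbT.
split=> [inc h bM|hold c dc /csat_conj_at bM].
  have /csat_disj_at[A [hA Ax MA]] : csat M (disj_at (head r) x) (h x).
    apply: inc; last first.
      by apply/csat_conj_at => A bA Ax; have := bM A bA; rewrite Ax.
    (* Inclusions speak about domain elements only; a body atom on [x] puts [h x] into the
       domain. *)
    have /hasP[A bA _]: has predT (body r).
      by rewrite has_predT lt0n size_eq0 body_nonempty.
    by apply: (has_fact_dom (bM A bA)); rewrite bx ?mem_head.
  by exists A; rewrite // Ax.
apply/csat_disj_at; case: (hold (fun=> c)) => [A bA|A hA MA].
  by have Ax := bx _ bA; rewrite Ax; apply: bM.
by exists A; split; rewrite ?hx //; move: MA; rewrite hx.
Qed.

Lemma binary_rule_inclusion r A0 R x y :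
  x != y -> A0 \in body r -> flat A0 = (role_sym R, [:: x; y]) ->
  (forall A, A \in head r -> arity (tag A) = 1) ->
  (forall A, A \in head r ++ body r ->
      [\/ A = A0 /\ A \in body r, tval (tagged A) = [:: x]
        | tval (tagged A) = [:: y]]) ->
  forall S (M : structure S) (e : void -> const),
  holds M e (inclusion
    (CAnd (conj_at (body r) x)
       (CEx R (CAnd (conj_at (body r) y) (CNot (disj_at (head r) y)))))
    (disj_at (head r) x)) <->
  rule_holds M r.
Proof.
move=> xNy bA0 [tA0 vA0] head1 rxy S M e; rewrite holds_inclusion rule_holdsE.
split=> [inc h bM|hold c dc [/csat_conj_at bx [d Rcd [/csat_conj_at b_y hy]]]].
  have Rxy : has_fact M (role_sym R) [:: h x; h y].
    by have := bM _ bA0; rewrite vA0 tA0.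
  have dx : h x \in dom M by apply: has_fact_dom Rxy _; rewrite mem_head.
  (* Either a head atom on [y] already holds, or its failure supplies the negated conjunct under the
     existential. *)
  have [/csat_disj_at[A [hA Ay MA]]|hyN] := EM (csat M (disj_at (head r) y) (h y)).
    by exists A; rewrite // Ay.
  have /csat_disj_at[A [hA Ax MA]] : csat M (disj_at (head r) x) (h x).
    apply: inc dx _; split; first by apply/csat_conj_at => A bA Ax; have := bM A bA; rewrite Ax.
    exists (h y) => //; split=> //.
    by apply/csat_conj_at => A bA Ay; have := bM A bA; rewrite Ay.
  by exists A; rewrite // Ax.
(* As [x] and [y] differ, they can be sent to the two ends [c] and [d] of an arbitrary edge. *)
pose h z := if z == x then c else d.
have hxE : h x = c by rewrite /h eqxx.
have hyE : h y = d by rewrite /h eq_sym (negPf xNy).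
have [A bA|A hA MA] := hold h.
  have [|[-> _]|Ax|Ay] := rxy A; first by rewrite mem_cat bA orbT.
  - by rewrite vA0 tA0 /= hxE hyE.
  - by rewrite Ax /= hxE; apply: bx.
  - by rewrite Ay /= hyE; apply: b_y.
have [|[EA _]|Ax|Ay] := rxy A; first by rewrite mem_cat hA.
- by have := head1 _ hA; rewrite EA tA0.
- by apply/csat_disj_at; exists A; move: MA; rewrite Ax /= hxE.
- by case: hy; apply/csat_disj_at; exists A; move: MA; rewrite Ay /= hyE.
Qed.

(** A binary body atom must be an EDB atom. By simplicity it is then the only EDB atom and has
    distinct variables, so all other body atoms are unary. *)
Lemma rule_inclusion (E : schema) r : connected_rule r -> simple_rule E r ->
  (forall A, A \in head r -> arity (tag A) = 1) ->
  (forall A, A \in body r -> arity (tag A) = 1 \/ tag A \in E /\ arity (tag A) = 2) ->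
  exists2 phi, ALC phi & forall S (M : structure S) (e : void -> const),
    holds M e phi <-> rule_holds M r.
Proof.
move=> conn_r [sizeE uniqE] head1 body12.
have [|] := boolP (has (fun A => arity (tag A) == 2) (body r)).
  case/hasP=> A0 bA0 /eqP ar2.
  have EA0 : A0 \in [seq A <- body r | tag A \in E].
    rewrite mem_filter bA0 andbT.
    by case: (body12 _ bA0) => [|[]//]; rewrite ar2.
  have [A bA|R [x [y [xNy flatA0 rxy]]]] :=
      binary_rule_shape conn_r head1 bA0 ar2 (uniqE _ EA0).
    case: (body12 _ bA) => [|[EA _]]; first by left.
    right; have: A \in [seq A <- body r | tag A \in E] by rewrite mem_filter EA.
    move: EA0 sizeE; case: [seq _ <- _ | _] => [|B []] //.
    by rewrite !inE => /eqP-> _ /eqP->.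
  exists (inclusion (CAnd (conj_at (body r) x)
       (CEx R (CAnd (conj_at (body r) y) (CNot (disj_at (head r) y)))))
    (disj_at (head r) x)); first by do 2 eexists.
  by move=> S M e; apply: binary_rule_inclusion flatA0 _ _ _ _ _.
move/hasPn => bN2; have [A bA|x rx] := unary_rule_shape conn_r head1.
  by case: (body12 _ bA) => // -[_ /eqP]; rewrite (negPf (bN2 _ bA)).
exists (inclusion (conj_at (body r) x) (disj_at (head r) x)).
  by do 2 eexists.
by move=> S M e; apply: unary_rule_inclusion.
Qed.

(** * Programs as ontologies *)

Lemma mem_idb Pi R :
  R \in idb Pi <->
  exists2 r, List.In r (rules Pi) & R \in [seq tag A | A <- head r].
Proof. by rewrite inE; apply: mem_flatten_map. Qed.

Lemma mem_edb Pi R :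
  R \in edb Pi <-> R \notin idb Pi /\
  exists2 r, List.In r (rules Pi) & R \in [seq tag A | A <- body r].
Proof.
rewrite in_fsetD; split=> [/andP[-> ]|[-> bR]].
  by rewrite inE => /mem_flatten_map.
by rewrite inE; apply/mem_flatten_map.
Qed.

Lemma head_idb Pi r A : List.In r (rules Pi) -> A \in head r -> tag A \in idb Pi.
Proof. by move=> Pir hA; apply/mem_idb; exists r => //; apply: map_f. Qed.

Lemma body_schema Pi r A :
  List.In r (rules Pi) -> A \in body r -> tag A \in idb Pi `|` edb Pi.
Proof.
move=> Pir bA; rewrite inE; case: (boolP (tag A \in idb Pi)) => //= NA.
by apply/mem_edb; split=> //; exists r => //; apply: map_f.
Qed.

(** The equivalence ranges over all schemas because the schema of the final query depends on the
    signature of the ontology, which is enlarged afterwards. *)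
Lemma rules_ontology (Pi : program) : binary (edb Pi) ->
  monadic Pi -> unary Pi -> connected Pi -> simple Pi ->
  exists2 O, is_ontology ALC O & forall S (M : structure S),
    satisfies M O <-> List.Forall (rule_holds M) (rules Pi).
Proof.
move=> bin mon un /List.Forall_forall conn /List.Forall_forall simp.
have idb1 R : R \in idb Pi -> arity R = 1.
  by move=> iR; have [->//|/mon->] := eqVneq R (goal Pi).
have rule_phi r : List.In r (rules Pi) -> exists2 phi, ALC phi &
    forall S (M : structure S) (e : void -> const),
    holds M e phi <-> rule_holds M r.
  move=> Pir; apply: rule_inclusion (conn _ Pir) (simp _ Pir) _ _ => A rA.
    exact/idb1/(head_idb Pir).
  have := body_schema Pir rA; rewrite inE => /orP[/idb1|EA]; first by left.
  by case: (bin _ EA) => [|A2]; [left|right].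
elim: (rules Pi) rule_phi => [|r rs IHrs] rule_phi.
  by exists [::]; [constructor|split=> _; constructor].
have [phi ALCphi phiE] := rule_phi r (or_introl erefl).
have [s sr|O ALCO OE] := IHrs; first by apply: rule_phi; right.
exists (phi :: O); first by constructor.
move=> S M; rewrite /satisfies !List.Forall_cons_iff.
by rewrite -OE -(phiE S M (of_void const)).
Qed.

Section StructOf.
Variables (S : schema) (d : {fset const}) (P : relsym -> seq const -> Prop).
Definition struct_of (d0 : d != fset0) : structure S :=
  Structure d0 (adom_inst_of S d P).
End StructOf.

Definition restrict S (F : {fset fact}) : instance S :=
  inst_of S (adom F) (has_fact F).

Lemma restrictP S (F : {fset fact}) R s :
  has_fact (restrict S F) R s <-> R \in S /\ has_fact F R s.
Proof.
rewrite inst_factsP; split=> [[]//|[SR FR]]; split=> //.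
  exact: has_fact_size FR.
by move=> c sc; apply/adomP; exists R, s.
Qed.

(** Restricting to the symbols of the program creates no new body match, and it keeps the head
    facts, whose symbols are IDB. *)
Lemma rules_restrict Pi (F : {fset fact}) :
  List.Forall (rule_holds F) (rules Pi) ->
  List.Forall (rule_holds (restrict (idb Pi `|` edb Pi) F)) (rules Pi).
Proof.
move=> /List.Forall_forall FPi.
apply/List.Forall_forall => r Pir; apply/rule_holdsE => h bD'.
have /rule_holdsE/(_ h)[A bA|A hA MA] := FPi r Pir.
  by have /restrictP[] := bD' A bA.
by exists A => //; apply/restrictP; rewrite in_fsetU (head_idb Pir hA).
Qed.

Lemma MDDlog_to_ALC_AQ : at_least_as_expressive_over binary (OMQ ALC AQ) UCS_MDDlog.
Proof.
move=> S0 n q binS UCSq; case: UCSq binS => {S0 n q} Pi [mon un conn simp] bin.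
have [O ALCO OE] := rules_ontology bin mon un conn simp.
have idb1 R : R \in idb Pi -> arity R = 1.
  by move=> iR; have [->//|/mon->] := eqVneq R (goal Pi).
have goalE : goal Pi = concept_sym (goal Pi).1.
  by move: un; rewrite /unary /arity; case: (goal Pi) => g k /= ->.
(* Inclusions [A <= T] put every IDB symbol and the goal into the signature. *)
pose tops := [seq inclusion (CName A) CTop
             | A <- (goal Pi).1 :: [seq R.1 | R <- idb Pi]].
have in_sig A : A \in (goal Pi).1 :: [seq R.1 | R <- idb Pi] ->
    concept_sym A \in sig (tops ++ O).
  move=> tA.
  apply: (fsubsetP (@sig_formula_sub_sig (inclusion (CName A) CTop) _ _)).
    exact/In_catl/(In_map (fun B => inclusion (CName B) CTop))/in_List.
  by rewrite /= in_fsetU in_fset1 eqxx.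
have sub_sig R : R \in idb Pi `|` edb Pi -> R \in edb Pi `|` sig (tops ++ O).
  rewrite in_fsetU => /orP[iR|eR]; rewrite in_fsetU; last by rewrite eR.
  rewrite (_ : R = concept_sym R.1); last first.
    by move: (idb1 _ iR); rewrite /arity; case: (R) => m k /= ->.
  by rewrite in_sig ?orbT // inE map_f ?orbT.
have satE S' (M : structure S') :
    satisfies M (tops ++ O) <-> List.Forall (rule_holds M) (rules Pi).
  rewrite /satisfies Forall_cat -OE; split=> [[]//|MO]; split=> //.
  by apply/Forall_mapP => A _; apply/holds_inclusion.
apply: (@OMQ_AQ_intro _ _ _ (tops ++ O) (goal Pi).1 un).
- apply/Forall_cat; split=> //.
  by apply/Forall_mapP => A _; do 2 eexists.
- by rewrite in_fsetU in_sig ?orbT ?mem_head.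
move=> D a; split=> -[sub_a ansD]; split=> //.
  move=> M /satE MPi DM.
  pose D' := restrict (idb Pi `|` edb Pi) M.
  suff /restrictP[_]: has_fact D' (goal Pi) a by rewrite -goalE.
  rewrite -mkfact_in; apply: ansD; last exact: rules_restrict.
  apply/has_fact_subP => R s DR; apply/restrictP; split.
    by rewrite in_fsetU (has_fact_over DR) orbT.
  by move/has_fact_subP: DM; apply.
move=> D' DD' D'Pi.
(* The active domain of [D'] will be the domain of a structure. It is nonempty because the answer
   tuple has an entry, which occurs in [D]. *)
have d0 : adom D' != fset0.
  have /hasP[c ac _]: has predT a by rewrite has_predT size_tuple (un : arity _ = 1).
  have /adomP[R [s [DR sc]]] := sub_a _ ac.
  apply/fset0Pn; exists c.
  by apply/adomP; exists R, s; split=> //; move/has_fact_subP: DD'; apply.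
pose M := struct_of (edb Pi `|` sig (tops ++ O)) (has_fact D') d0.
have ME : facts M = facts D'.
  apply/fsetP => f; rewrite !in_has_fact; apply/idP/idP => [/inst_factsP[]//|D'f].
  apply/inst_factsP; split=> //; rewrite ?size_tuple //.
    exact/sub_sig/(has_fact_over D'f).
  by move=> c fc; apply/adomP; exists (tag f), (tagged f).
suff: has_fact M (concept_sym (goal Pi).1) a by rewrite -goalE ME mkfact_in.
apply: ansD; last by rewrite ME.
by apply/satE; rewrite ME.
Qed.

(** * Programs given by one schema atom per rule *)

(** As in [OMQ_AQ_intro], equations replace indices that agree only provably: here the EDB schema
    and the arity of the goal. *)
Lemma UCS_MDDlog_intro Pi S n (q : query S n) :
  edb Pi = S -> arity (goal Pi) = n ->
  [/\ monadic Pi, unary Pi, connected Pi & simple Pi] ->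
  (forall (D : instance S) a, q D a <-> {subset a <= adom D} /\
     forall D' : instance (idb Pi `|` S), facts D `<=` facts D' ->
       List.Forall (rule_holds D') (rules Pi) -> has_fact D' (goal Pi) a) ->
  exists q2 : query S n, UCS_MDDlog q2 /\ equivalent q q2.
Proof.
move=> eS en; subst S n => UCS qE; exists (ddlog_query Pi); split=> // D a.
rewrite qE; split=> -[sub_a H]; split=> // D' DD' D'Pi.
  by rewrite mkfact_in; apply: H.
by rewrite -mkfact_in; apply: H.
Qed.

Definition concept_atom (A : nat) (x : var) : atom :=
  existT (fun R : relsym => (arity R).-tuple var) (concept_sym A) [tuple x].

Definition schema_atom (R : relsym) : atom :=
  existT (fun R : relsym => (arity R).-tuple var) R [tuple of iota 0 (arity R)].

(* [Tagged _ (hd, bd)] with tag [R] encodes the rule with body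
   [R(0, ..., k-1)], [A(x)] for [(A, x)] in [bd], and head [A(x)] for [(A, x)]
   in [hd]. *)
Definition code :=
  {R : relsym & (seq (nat * 'I_(arity R)) * seq (nat * 'I_(arity R)))%type}.

Definition code_head (w : code) := (tagged w).1.
Definition code_body (w : code) := (tagged w).2.

Definition concept_atoms k (l : seq (nat * 'I_k)) : seq atom :=
  [seq concept_atom p.1 p.2 | p : nat * 'I_k <- l].

(** Variables of a code are positions below the arity, and the schema atom lists all of these. *)
Lemma code_rule_safe (w : code) :
  {subset atoms_vars (concept_atoms (code_head w)) <=
          atoms_vars (schema_atom (tag w) :: concept_atoms (code_body w))}.
Proof.
move=> x /flatten_mapP[_ /mapP[p _ ->]]; rewrite mem_seq1 => /eqP->.
by rewrite /atoms_vars /= mem_cat mem_iota /= ltn_ord.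
Qed.

Definition code_rule (w : code) : rule :=
  @Rule (concept_atoms (code_head w))
        (schema_atom (tag w) :: concept_atoms (code_body w))
        isT (@code_rule_safe w).

(** The schema atom lists each variable once, so the substitutions satisfying it correspond to the
    tuples [s] of the relation, with [nth 0 s] as substitution. The default 0 is never reached at a
    position below the arity. *)
Lemma code_rule_holds (D : {fset fact}) (w : code) :
  rule_holds D (code_rule w) <->
  forall s, has_fact D (tag w) s ->
    (forall p, p \in code_body w -> has_fact D (concept_sym p.1) [:: nth 0 s p.2]) ->
    exists2 p, p \in code_head w & has_fact D (concept_sym p.1) [:: nth 0 s p.2].
Proof.
rewrite rule_holdsE; split=> [hold s Ds bD|hold h bD].
  have [A|_ /mapP[p hp ->] Dp] := hold (nth 0 s); last by exists p.
  rewrite inE => /predU1P[->|/mapP[p bp ->]]; last exact: bD.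
  by rewrite /= -(has_fact_size Ds) map_nth_iota0 // take_size.
have nthE k : k < arity (tag w) -> nth 0 (map h (iota 0 (arity (tag w)))) k = h k.
  by move=> lt_k; rewrite (nth_map 0) ?size_iota // nth_iota.
have [||p hp Dp] := hold (map h (iota 0 (arity (tag w)))).
- by apply: (bD (schema_atom (tag w))); rewrite mem_head.
- move=> p bp; rewrite nthE //; apply: (bD (concept_atom p.1 p.2)).
  by rewrite inE (map_f (fun p : nat * 'I__ => concept_atom p.1 p.2)) ?orbT.
exists (concept_atom p.1 p.2); last by move: Dp; rewrite nthE.
exact: (map_f (fun p : nat * 'I__ => concept_atom p.1 p.2)).
Qed.

(** All variables co-occur in the schema atom, so a path of length one suffices. *)
Lemma code_rule_connected (w : code) : connected_rule (code_rule w).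
Proof.
have vars x : x \in rule_vars (code_rule w) -> x \in iota 0 (arity (tag w)).
  rewrite /rule_vars /= mem_cat => rx.
  have: x \in atoms_vars (schema_atom (tag w) :: concept_atoms (code_body w)).
    by case/orP: rx => // /code_rule_safe.
  rewrite /atoms_vars /= mem_cat => /orP[//|/flatten_mapP[_ /mapP[p _ ->]]].
  by rewrite mem_seq1 => /eqP->; rewrite mem_iota /= ltn_ord.
move=> x y /vars wx /vars wy; exists [:: y] => //=; rewrite andbT.
by apply/hasP; exists (schema_atom (tag w)); rewrite ?mem_head //= wx wy.
Qed.

Section CodeProgram.
Variables (S : schema) (g : nat) (ws : seq code).
Hypothesis tag_ws : forall w, w \in ws -> tag w \in S.
Hypothesis ws_tag : forall R, R \in S -> exists2 w, w \in ws & tag w = R.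
Hypothesis head_fresh : forall w p,
  w \in ws -> p \in code_head w -> concept_sym p.1 \notin S.
Hypothesis body_fresh : forall w p,
  w \in ws -> p \in code_body w -> p.1 != g.
Hypothesis g_fresh : concept_sym g \notin S.
Hypothesis body_head : forall w p, w \in ws -> p \in code_body w ->
  exists w' p', [/\ w' \in ws, p' \in code_head w' & p'.1 = p.1].
Hypothesis g_head : forall w p, w \in ws -> p \in code_head w -> p.1 = g ->
  size (code_head w) = 1.

Lemma code_goal_notin_body : List.Forall
  (fun r => concept_sym g \notin [seq tag A | A <- body r]) (map code_rule ws).
Proof.
apply/Forall_mapP => w ws_w; rewrite /= inE negb_or; apply/andP; split.
  by apply: contraNneq g_fresh => ->; apply: tag_ws.
rewrite /concept_atoms -map_comp; apply/mapP => -[p bp [] /eqP].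
by rewrite eq_sym (negPf (body_fresh ws_w bp)).
Qed.

Lemma code_goal_head : List.Forall
  (fun r => concept_sym g \in [seq tag A | A <- head r] -> size (head r) = 1)
  (map code_rule ws).
Proof.
apply/Forall_mapP => w ws_w /=; rewrite /concept_atoms -map_comp size_map.
by case/mapP=> p hp [/esym]; apply: g_head ws_w hp.
Qed.

Definition code_program : program :=
  Program code_goal_notin_body code_goal_head.

Lemma idb_code_program R : R \in idb code_program <->
  exists w p, [/\ w \in ws, p \in code_head w & R = concept_sym p.1].
Proof.
rewrite inE /= -map_comp; split=> [/flatten_mapP[w ws_w]|[w [p [ws_w hp ->]]]].
  by rewrite /= /concept_atoms -map_comp => /mapP[p hp ->]; exists w, p.
apply/flatten_mapP; exists w => //=; rewrite /concept_atoms -map_comp.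
by apply/mapP; exists p.
Qed.

(** By [body_head] every concept atom of a body also has its symbol in some head, so it is IDB and
    only schema atoms contribute EDB symbols. Head names are fresh and each symbol of [S] has a
    code, so nothing of [S] is lost. *)
Lemma edb_code_program : edb code_program = S.
Proof.
apply/fsetP => R; rewrite in_fsetD; apply/andP/idP => [[NR]|SR].
  rewrite inE /= -map_comp => /flatten_mapP[w ws_w] /=.
  rewrite inE => /predU1P[->|]; first exact: tag_ws.
  rewrite /concept_atoms -map_comp => /mapP[p bp ER].
  case/negP: NR; apply/idb_code_program.
  have [w' [p' [ws_w' hp' Ep]]] := body_head ws_w bp.
  by exists w', p'; split=> //; rewrite ER Ep.
split.
  apply/negP => /idb_code_program[w [p [ws_w hp ER]]].
  by case/negP: (head_fresh ws_w hp); rewrite -ER.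
have [w ws_w <-] := ws_tag SR.
rewrite inE /= -map_comp; apply/flatten_mapP; exists w => //=.
by rewrite mem_head.
Qed.

Lemma code_program_UCS :
  [/\ monadic code_program, unary code_program, connected code_program
    & simple code_program].
Proof.
split=> //.
- by move=> R /idb_code_program[w [p [_ _ ->]]].
- by apply/Forall_mapP => w _; apply: code_rule_connected.
apply/Forall_mapP => w ws_w; rewrite /simple_rule edb_code_program /=.
rewrite tag_ws // (_ : [seq _ <- concept_atoms _ | _] = [::]) /=.
  by split=> // A; rewrite mem_seq1 => /eqP->; apply: iota_uniq.
apply/eqP; rewrite -[_ == _]negbK -has_filter; apply/hasPn => _ /mapP[p bp ->] /=.
have [w' [p' [ws_w' hp' <-]]] := body_head ws_w bp.
exact: head_fresh ws_w' hp'.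
Qed.

End CodeProgram.

(** * Types *)

Fixpoint subconcepts (C : concept) : seq concept :=
  C :: match C with
       | CName _ | CTop | CBot => [::]
       | CNot D | CEx _ D | CAll _ D => subconcepts D
       | CAnd D E | COr D E => subconcepts D ++ subconcepts E
       end.

(** Types arise without enumerating sets of concepts: each [u] of the list splits [P] into the part
    where [u] holds and the part where it fails, and the index types of the two parts are summed.
    The result is empty when nothing satisfies [P]. *)
Lemma finite_representatives (X U : Type) (sat : X -> U -> Prop)
    (P : X -> Prop) (l : seq U) :
  exists (I : finType) (m : I -> X), (forall i, P (m i)) /\
    forall x, P x -> exists i, forall u, List.In u l -> (sat x u <-> sat (m i) u).
Proof.
elim: l P => [|u l IHl] P.
  have [[x Px]|NP] := EM (exists x, P x).
    by exists unit, (fun=> x); split=> // y _; exists tt.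
  by exists void, (fun i : void => match i with end); split=> [[]|x Px]; case: NP; exists x.
have [I [m [Pm repm]]] := IHl (fun x => P x /\ sat x u).
have [J [n [Pn repn]]] := IHl (fun x => P x /\ ~ sat x u).
exists (I + J)%type, (fun k => match k with inl i => m i | inr j => n j end).
split=> [[i|j]|x Px]; [by case: (Pm i)|by case: (Pn j)|].
have [xu|xNu] := EM (sat x u).
  have [i xi] := repm x (conj Px xu); exists (inl i) => v [<-|/xi //].
  by split=> // _; case: (Pm i).
have [j xj] := repn x (conj Px xNu); exists (inr j) => v [<-|/xj //].
by split=> // nu; case: (Pn j).
Qed.

Section Types.
Variables (S : schema) (O : ontology) (incs : seq (concept * concept)).
Hypothesis satO : forall M : structure S, satisfies M O <->
  forall p, List.In p incs ->
    forall c, c \in dom M -> csat M p.1 c -> csat M p.2 c.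
Variable cl : seq concept.
Hypothesis incs_cl : forall p, List.In p incs ->
  List.incl (subconcepts p.1) cl /\ List.incl (subconcepts p.2) cl.

Definition is_pmodel (x : structure S * const) : Prop :=
  satisfies x.1 O /\ x.2 \in dom x.1.

Variables (I : finType) (m : I -> structure S * const).
Hypothesis m_pmodel : forall i, is_pmodel (m i).
Hypothesis m_rep : forall x, is_pmodel x -> exists i,
  forall C, List.In C cl -> (csat x.1 C x.2 <-> csat (m i).1 C (m i).2).

Definition tsat (i : I) (C : concept) : Prop := csat (m i).1 C (m i).2.

Definition has_type (M : structure S) (c : const) (i : I) : Prop :=
  forall C, List.In C cl -> (csat M C c <-> tsat i C).

(** The largest accessibility relation of a filtration through [cl]. *)
Definition may_follow (R : nat) (i j : I) : Prop :=
  forall C, List.In C cl ->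
    (List.In (CEx R C) cl -> tsat j C -> tsat i (CEx R C)) /\
    (List.In (CAll R C) cl -> tsat i (CAll R C) -> tsat j C).

Lemma edge_may_follow (M : structure S) R c d i j :
  has_type M c i -> has_type M d j -> has_fact M (role_sym R) [:: c; d] ->
  may_follow R i j.
Proof.
move=> ci dj Rcd C clC; split=> clR iC.
  by apply/ci => //; exists d => //; apply/dj.
by apply/dj => //; move/(ci _ clR): iC; apply.
Qed.

(** The successor [d] lives in [(m i).1], which is a model of [O], so [m_rep] assigns it a type as
    well. *)
Lemma type_successor i R d : has_fact (m i).1 (role_sym R) [:: (m i).2; d] ->
  exists2 j, may_follow R i j & has_type (m i).1 d j.
Proof.
move=> Rid; have [Mi _] := m_pmodel i.
have dd : d \in dom (m i).1 by apply: has_fact_dom Rid _; rewrite !inE eqxx orbT.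
have [j dj] := m_rep (x := ((m i).1, d)) (conj Mi dd).
by exists j => //; apply: edge_may_follow Rid.
Qed.

(** Symbols of arity other than one or two occur in no concept, so their facts are unconstrained. *)
Definition allowed (R : relsym) (t : seq I) : Prop :=
  match t with
  | [:: i] => tsat i (CName R.1)
  | [:: i; j] => may_follow R.1 i j
  | _ => True
  end.

Lemma fact_allowed (M : structure S) R s t :
  (forall A, concept_sym A = R -> List.In (CName A) cl) ->
  arity R = 1 \/ arity R = 2 -> has_fact M R s -> size t = size s ->
  (forall k, k < size s -> forall i0, has_type M (nth 0 s k) (nth i0 t k)) ->
  allowed R t.
Proof.
case: R => A k clA ar12 MR; move: (MR) => /has_fact_size; rewrite /arity /=.
case: ar12 => /= k_val; move: MR clA; rewrite /arity /= in k_val; rewrite k_val.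
  case: s => [|c []] //; case: t => [|i []] //= MA clA _ _ /(_ 0 isT i) ci.
  by apply/ci => //; apply: clA.
case: s => [|c [|d []]] //; case: t => [|i [|j []]] //= MR _ _ _ ty.
exact: edge_may_follow (ty 0 isT i) (ty 1 isT i) MR.
Qed.

(** * Models built from labellings by types *)

Section TypeModel.
Variables (d : {fset const}) (d0 : d != fset0) (lab : const -> I).
Hypothesis lab_surj : forall j, exists2 u, u \in d & lab u = j.

Definition type_model : structure S :=
  struct_of S (fun R s => allowed R (map lab s)) d0.

Lemma type_modelP R s : has_fact type_model R s <->
  [/\ R \in S, size s = arity R, {subset s <= d} & allowed R (map lab s)].
Proof. exact: inst_factsP. Qed.

Lemma type_model_edge R u v : role_sym R \in S -> u \in d -> v \in d ->
  may_follow R (lab u) (lab v) -> has_fact type_model (role_sym R) [:: u; v].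
Proof.
move=> SR du dv uv; apply/type_modelP; split=> // c.
by rewrite !inE => /orP[] /eqP->.
Qed.

(** The truth lemma of the filtration. An edge implies [may_follow], which passes on existential and
    universal concepts of [cl]. Conversely, a successor in a representative model has a type, this
    type labels some element of [d] by [lab_surj], and the edge to that element is present because
    all permitted edges are. *)
Lemma csat_type_model C u : List.incl (subconcepts C) cl -> u \in d ->
  csat type_model C u <-> tsat (lab u) C.
Proof.
elim: C u => [A|||C IH|C IHC D IHD|C IHC D IHD|R C IH|R C IH] u inc du //=.
- split=> [/type_modelP[]//|uA]; apply/type_modelP; split=> //.
    exact: has_fact_over uA.
  by move=> c; rewrite inE => /eqP->.
- rewrite IH //; by move=> D CD; apply: inc; right.
- rewrite IHC ?IHD // => E inE; apply: inc; right; [exact: In_catr|exact: In_catl].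
- rewrite IHC ?IHD // => E inE; apply: inc; right; [exact: In_catr|exact: In_catl].
- have clR : List.In (CEx R C) cl by apply: inc; left.
  have incC : List.incl (subconcepts C) cl by move=> D CD; apply: inc; right.
  have clC : List.In C cl by apply: incC; case: (C); left.
  split=> [[v /type_modelP[_ _ sub_d uv] Cv]|[e Re Ce]].
    have dv : v \in d by apply: sub_d; rewrite !inE eqxx orbT.
    by case: (uv _ clC) => /(_ clR) + _; apply; apply/IH.
  have [j follow_j ej] := type_successor Re.
  have [v dv vj] := lab_surj j; exists v; last by apply/IH; rewrite // vj; apply/ej.
  by apply: type_model_edge; rewrite ?vj //; apply: has_fact_over Re.
- have clR : List.In (CAll R C) cl by apply: inc; left.
  have incC : List.incl (subconcepts C) cl by move=> D CD; apply: inc; right.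
  have clC : List.In C cl by apply: incC; case: (C); left.
  split=> [uC e Re|iC v /type_modelP[_ _ sub_d uv]].
    have [j follow_j ej] := type_successor Re.
    have [v dv vj] := lab_surj j; apply/ej => //; rewrite -vj; apply/IH => //.
    by apply/uC/type_model_edge; rewrite ?vj //; apply: has_fact_over Re.
  have dv : v \in d by apply: sub_d; rewrite !inE eqxx orbT.
  by apply/IH => //; case: (uv _ clC) => _ /(_ clR); apply.
Qed.

(** By the truth lemma an inclusion can be checked at the representative of the label, which lies in
    a model of [O]. *)
Lemma type_model_satisfies : satisfies type_model O.
Proof.
apply/satO => p incp u du; have [inc1 inc2] := incs_cl incp.
rewrite !csat_type_model //; have [/satO sat_u du'] := m_pmodel (lab u).
exact: sat_u.
Qed.

End TypeModel.

(** * From ALC to MDDlog *)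

Section TypeProgram.
Variables (E : schema) (A0 : nat).
Hypothesis binE : binary E.
Hypothesis E_sub : forall R, R \in E -> R \in S.
Hypothesis E_cl : forall A, concept_sym A \in E -> List.In (CName A) cl.
Hypothesis A0_cl : List.In (CName A0) cl.

(** A name above all names of [E]; the type names follow strictly after it. *)
Definition goal_name : nat := (\max_(R <- E) R.1).+1.
Definition type_name (i : I) : nat := goal_name.+1 + enum_rank i.

Lemma fresh_name A : goal_name <= A -> concept_sym A \notin E.
Proof.
apply: contraL => EA; rewrite -ltnNge ltnS.
exact: (leq_bigmax_seq (F := fun R : relsym => R.1) (concept_sym A) EA).
Qed.

Lemma type_name_fresh i : concept_sym (type_name i) \notin E.
Proof. by apply: fresh_name; rewrite /type_name addSn -addnS leq_addr. Qed.

Lemma type_name_inj : injective type_name.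
Proof. by move=> i j /addnI/ord_inj/enum_rank_inj. Qed.

Lemma type_name_goal i : type_name i == goal_name = false.
Proof. by rewrite /type_name addSn -addnS -{2}[goal_name]addn0 eqn_add2l. Qed.

Let mk_code (R : relsym) hd bd : code :=
  Tagged (fun R => seq (nat * 'I_(arity R)) * seq (nat * 'I_(arity R)))%type
         (i := R) (hd, bd).

(** The rule that guesses a type for the constant at position [k]. If there are no types, its head
    is empty and any [R] fact is rejected. *)
Definition label_code R (k : 'I_(arity R)) : code :=
  mk_code [seq (type_name i, k) | i <- enum I] [::].

Definition clash_code R (t : (arity R).-tuple I) : code :=
  mk_code [::] [seq (type_name (tnth t k), k) | k <- enum 'I_(arity R)].

Definition goal_code R (ik : I * 'I_(arity R)) : code :=
  mk_code [:: (goal_name, ik.2)] [:: (type_name ik.1, ik.2)].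

(** Since every rule carries a schema atom, labelling and goal rules are repeated for each symbol
    and position; this reaches all constants of the active domain. *)
Definition type_codes : seq code :=
  flatten [seq
      [seq label_code k | k <- enum 'I_(arity R)]
      ++ [seq clash_code t | t : (arity R).-tuple I <- enum predT & ~~ `[< allowed R t >]]
      ++ [seq goal_code ik | ik : I * 'I_(arity R) <- enum predT
                           & `[< tsat ik.1 (CName A0) >]]
    | R <- E].

Lemma type_codesP w : w \in type_codes <-> exists2 R, R \in E &
  [\/ exists k : 'I_(arity R), w = label_code k,
      exists2 t : (arity R).-tuple I, ~ allowed R t & w = clash_code t
    | exists2 ik : I * 'I_(arity R), tsat ik.1 (CName A0) & w = goal_code ik].
Proof.
split=> [/flatten_mapP[R ER]|[R ER wR]].
  rewrite !mem_cat => /or3P[] /mapP[x Hx ->]; exists R => //.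
  - by constructor 1; exists x.
  - by move: Hx; rewrite mem_filter => /andP[/asboolPn Hx _]; constructor 2; exists x.
  - by move: Hx; rewrite mem_filter => /andP[/asboolP Hx _]; constructor 3; exists x.
apply/flatten_mapP; exists R => //; rewrite !mem_cat.
case: wR => [[k ->]|[t Nt ->]|[ik iA ->]]; apply/or3P.
- by constructor 1; apply: map_f; rewrite mem_enum.
- by constructor 2; apply: map_f; rewrite mem_filter mem_enum andbT; apply/asboolPn.
- by constructor 3; apply: map_f; rewrite mem_filter mem_enum andbT; apply/asboolP.
Qed.

Lemma type_codes_tag w : w \in type_codes -> tag w \in E.
Proof.
by case/type_codesP=> R ER [[k ->]|[t _ ->]|[ik _ ->]].
Qed.

Lemma type_codes_surj R : R \in E -> exists2 w, w \in type_codes & tag w = R.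
Proof.
move=> ER; have R0 : 0 < arity R by case: (binE ER) => ->.
exists (label_code (Ordinal R0)) => //; apply/type_codesP; exists R => //.
by constructor 1; exists (Ordinal R0).
Qed.

Lemma type_codes_head w p : w \in type_codes -> p \in code_head w ->
  p.1 = goal_name /\ size (code_head w) = 1 \/ exists i, p.1 = type_name i.
Proof.
move=> /type_codesP cw; move: p; case: cw => R ER [[k ->]|[t _ ->]|[ik _ ->]] p //=.
  by case/mapP=> i _ ->; right; exists i.
by rewrite inE => /eqP ->; left.
Qed.

Lemma type_codes_body w p : w \in type_codes -> p \in code_body w ->
  exists i, p.1 = type_name i.
Proof.
move=> /type_codesP cw; move: p; case: cw => R ER [[k ->]|[t _ ->]|[ik _ ->]] p //=.
  by case/mapP=> k _ ->; exists (tnth t k).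
by rewrite inE => /eqP ->; exists ik.1.
Qed.

Lemma type_codes_head_fresh w p :
  w \in type_codes -> p \in code_head w -> concept_sym p.1 \notin E.
Proof.
move=> cw hp; have [[-> _]|[i ->]] := type_codes_head cw hp.
  exact: fresh_name.
exact: type_name_fresh.
Qed.

Lemma type_codes_body_fresh w p :
  w \in type_codes -> p \in code_body w -> p.1 != goal_name.
Proof.
by move=> cw bp; have [i ->] := type_codes_body cw bp; rewrite type_name_goal.
Qed.

(** The head of any labelling rule lists all type names. *)
Lemma type_codes_body_head w p : w \in type_codes -> p \in code_body w ->
  exists w' p', [/\ w' \in type_codes, p' \in code_head w' & p'.1 = p.1].
Proof.
move=> cw bp; have [i ->] := type_codes_body cw bp.
have k := p.2; exists (label_code k), (type_name i, k); split=> //.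
  apply/type_codesP; exists (tag w); first exact: type_codes_tag.
  by constructor 1; exists k.
by apply: (map_f (fun i => (type_name i, k))); rewrite mem_enum.
Qed.

Lemma type_codes_goal_head w p : w \in type_codes -> p \in code_head w ->
  p.1 = goal_name -> size (code_head w) = 1.
Proof.
move=> cw hp Ep; have [[_ ->] //|[i Ei]] := type_codes_head cw hp.
by have := type_name_goal i; rewrite -Ei Ep eqxx.
Qed.

Definition type_program : program :=
  code_program type_codes_tag type_codes_body_fresh (fresh_name (leqnn _))
    type_codes_goal_head.

Lemma edb_type_program : edb type_program = E.
Proof.
exact: (edb_code_program _ type_codes_surj type_codes_head_fresh _ _
  type_codes_body_head).
Qed.

Lemma type_program_UCS :
  [/\ monadic type_program, unary type_program, connected type_program
    & simple type_program].
Proof.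
exact: (code_program_UCS _ type_codes_surj type_codes_head_fresh _ _
  type_codes_body_head).
Qed.

(** The three clauses are the readings of the labelling, clash and goal rules; [index c s] turns a
    constant of a fact into a position. Defaults [i0] are quantified because [I] may be empty. *)
Lemma type_rulesP (F : {fset fact}) :
  List.Forall (rule_holds F) (rules type_program) <->
  forall R s, R \in E -> has_fact F R s ->
  [/\ forall c, c \in s ->
        exists i, has_fact F (concept_sym (type_name i)) [:: c],
      forall t : seq I, size t = size s ->
        (forall k i0, k < size s ->
           has_fact F (concept_sym (type_name (nth i0 t k))) [:: nth 0 s k]) ->
        allowed R t
    & forall c i, c \in s -> tsat i (CName A0) ->
        has_fact F (concept_sym (type_name i)) [:: c] ->
        has_fact F (concept_sym goal_name) [:: c]].
Proof.
rewrite Forall_mapP; split=> [hold R s ER FR|hold w cw].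
  have szs := has_fact_size FR; split.
  - move=> c sc; have k_lt : index c s < arity R by rewrite -szs index_mem.
    have /code_rule_holds/(_ s FR)[//|p /mapP[i _ ->] Fi] :
        rule_holds F (code_rule (label_code (Ordinal k_lt))).
      by apply/hold/type_codesP; exists R => //; constructor 1; eexists.
    by exists i; move: Fi; rewrite /= nth_index.
  - move=> t szt Ft; apply: contrapT => Nt.
    have szt' : size t == arity R by rewrite szt szs.
    have /code_rule_holds/(_ s FR)[|p //] :
        rule_holds F (code_rule (clash_code (Tuple szt'))).
      by apply/hold/type_codesP; exists R => //; constructor 2; exists (Tuple szt').
    move=> p /mapP[k _ ->] /=; have i0 := tnth (Tuple szt') k.
    by rewrite (tnth_nth i0); apply: Ft; rewrite szs.
  move=> c i sc iA Fi; have k_lt : index c s < arity R by rewrite -szs index_mem.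
  have /code_rule_holds/(_ s FR)[|p] :
      rule_holds F (code_rule (goal_code (i, Ordinal k_lt))).
  - by apply/hold/type_codesP; exists R => //; constructor 3; exists (i, Ordinal k_lt).
  - by move=> p; rewrite mem_seq1 => /eqP->; rewrite /= nth_index.
  by rewrite mem_seq1 => /eqP->; rewrite /= nth_index.
apply/code_rule_holds => s; move: cw => /type_codesP[R ER cw] Fw.
have ERw : tag w = R by case: cw => [[k ->]|[t _ ->]|[ik _ ->]].
have Fs : has_fact F R s by rewrite -ERw.
have [lab clash goal] := hold R s ER Fs.
have szs := has_fact_size Fs.
case: cw => [[k ->]|[t Nt ->]|[ik iA ->]] /= bF.
- have [|i Fi] := lab (nth 0 s k); first by rewrite mem_nth ?szs.
  exists (type_name i, k) => //.
  by apply: (map_f (fun i => (type_name i, k))); rewrite mem_enum.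
- case: Nt; apply: clash => [|k i0 ks]; first by rewrite size_tuple.
  rewrite szs in ks; have := bF (type_name (tnth t (Ordinal ks)), Ordinal ks).
  rewrite (tnth_nth i0) /=; apply.
  rewrite -(tnth_nth i0 t (Ordinal ks)).
  by apply: (map_f (fun k => (type_name (tnth t k), k))); rewrite mem_enum.
exists (goal_name, ik.2); rewrite ?mem_head //=; apply: goal iA _.
  by rewrite mem_nth ?szs.
by apply: (bF (type_name ik.1, ik.2)); rewrite mem_head.
Qed.

(** One label per constant is chosen from [D']. The resulting type model satisfies [O] and contains
    [D], so [A0] holds there at [c]. Hence the label of [c] satisfies [A0], and a goal rule fires in
    [D']. *)
Lemma type_program_sound (D : instance E)
    (D' : instance (idb type_program `|` E)) c :
  c \in adom D -> D `<=` D' ->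
  List.Forall (rule_holds D') (rules type_program) ->
  (forall M : structure S, satisfies M O -> D `<=` M ->
     has_fact M (concept_sym A0) [:: c]) ->
  has_fact D' (concept_sym goal_name) [:: c].
Proof.
move=> Dc DD' /type_rulesP D'Pi cert.
have D'D : forall R s, has_fact D R s -> has_fact D' R s by apply/has_fact_subP.
have labelled u : u \in adom D ->
    exists i, has_fact D' (concept_sym (type_name i)) [:: u].
  case/adomP=> R [s [DR su]].
  by have [+ _ _] := D'Pi R s (has_fact_over DR) (D'D _ _ DR); apply.
(* The label of [c] shows that [I] is inhabited and serves as default label. *)
have [i0 _] := labelled c Dc.
(* From [N] on, constants are outside [D]; [N + enum_rank j] becomes the fresh element labelled [j],
   which makes the labelling surjective. *)
pose N := (\max_(u <- adom D) u).+1.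
have fresh k : ((N + k)%N \in adom D) = false.
  apply/negP => DN; have := leq_bigmax_seq (P := xpredT) (F := id) _ DN isT.
  by rewrite leqNgt /N addSn ltnS leq_addr.
pose lab u := odflt i0 [pick i |
  if u \in adom D then has_fact D' (concept_sym (type_name i)) [:: u]
  else u == (N + enum_rank i)%N].
pose d := adom D `|` [fset (N + enum_rank j)%N | j in I].
have lab_adom u : u \in adom D ->
    has_fact D' (concept_sym (type_name (lab u))) [:: u].
  move=> Du; rewrite /lab; case: pickP => [i|no]; first by rewrite Du.
  by have [i ui] := labelled u Du; have := no i; rewrite Du ui.
have lab_surj j : exists2 u, u \in d & lab u = j.
  exists (N + enum_rank j)%N.
    by rewrite in_fsetU; apply/orP; right; apply/imfsetP; exists j.
  rewrite /lab; case: pickP => [i|/(_ j)]; rewrite fresh ?eqxx //.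
  by rewrite eqn_add2l => /eqP/ord_inj/enum_rank_inj.
have dc : c \in d by rewrite in_fsetU Dc.
have d0 : d != fset0 by apply/fset0Pn; exists c.
have DM : D `<=` type_model d0 lab.
  apply/has_fact_subP => R s DR; have ER := has_fact_over DR.
  apply/type_modelP; split; [exact: E_sub|exact: has_fact_size DR| |].
    by move=> u su; rewrite in_fsetU; apply/orP; left; apply/adomP; exists R, s.
  have [_ + _] := D'Pi R s ER (D'D _ _ DR); apply; first by rewrite size_map.
  move=> k j ks; rewrite (nth_map 0) //; apply: lab_adom.
  by apply/adomP; exists R, s; rewrite mem_nth.
have /type_modelP[_ _ _ /= cA] := cert _ (type_model_satisfies d0 lab_surj) DM.
have [R [s [DR sc]]] := adomP _ _ Dc.
have [_ _] := D'Pi R s (has_fact_over DR) (D'D _ _ DR).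
by move/(_ c (lab c) sc cA); apply; apply: lab_adom.
Qed.

(** A model [M] of [O] labels the data: each constant of [D] receives every type it has in [M], and
    the goal exactly where [A0] holds in [M]. This satisfies the program, so a goal fact at [c]
    yields [A0] at [c] in [M]. *)
Lemma type_program_complete (D : instance E) (M : structure S) c :
  satisfies M O -> D `<=` M ->
  (forall D' : instance (idb type_program `|` E), D `<=` D' ->
     List.Forall (rule_holds D') (rules type_program) ->
     has_fact D' (concept_sym goal_name) [:: c]) ->
  has_fact M (concept_sym A0) [:: c].
Proof.
move=> MO DM cert.
pose names := [fset concept_sym (type_name i) | i in I] `|` [fset concept_sym goal_name].
pose Q R s := [\/ has_fact D R s,
  exists i u, [/\ R = concept_sym (type_name i), s = [:: u] & has_type M u i]
  | exists u, [/\ R = concept_sym goal_name, s = [:: u]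
                & has_fact M (concept_sym A0) [:: u]]].
pose F := inst_of (E `|` names) (adom D) Q.
have FD R s : has_fact D R s -> has_fact F R s.
  move=> DR; apply/inst_factsP; split; last by constructor 1.
  - by rewrite in_fsetU (has_fact_over DR).
  - exact: has_fact_size DR.
  - by move=> u su; apply/adomP; exists R, s.
(* Label and goal names are fresh, so over [E] nothing has been added to the data. *)
have DF R s : R \in E -> has_fact F R s -> has_fact D R s.
  move=> ER /inst_factsP[_ _ _ [//|[i [u [RE _ _]]]|[u [RE _ _]]]].
    by have := type_name_fresh i; rewrite -RE ER.
  by have := fresh_name (leqnn _); rewrite -RE ER.
have F_type i u : has_fact F (concept_sym (type_name i)) [:: u] <->
    u \in adom D /\ has_type M u i.
  split=> [/inst_factsP[_ _ sub_D Qi]|[Du ui]].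
    split; first by apply: sub_D; rewrite mem_head.
    case: Qi => [/has_fact_over|[j [v [/(congr1 fst)/type_name_inj <- [<-] //]]]|
                 [v [/(congr1 fst)/eqP]]].
      by rewrite (negPf (type_name_fresh i)).
    by rewrite /= type_name_goal.
  apply/inst_factsP; split=> //.
  - rewrite !in_fsetU; apply/orP; right; apply/orP; left.
    by apply/imfsetP; exists i.
  - by move=> v; rewrite mem_seq1 => /eqP->.
  by constructor 2; exists i, u.
have F_goal u : has_fact F (concept_sym goal_name) [:: u] <->
    u \in adom D /\ has_fact M (concept_sym A0) [:: u].
  split=> [/inst_factsP[_ _ sub_D Qi]|[Du uA]].
    split; first by apply: sub_D; rewrite mem_head.
    case: Qi => [/has_fact_over|[j [v [/(congr1 fst)/esym/eqP]]]|
                 [v [_ [<-]]//]].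
      by rewrite (negPf (fresh_name (leqnn _))).
    by rewrite /= type_name_goal.
  apply/inst_factsP; split=> //.
  - by rewrite !in_fsetU in_fset1 eqxx !orbT.
  - by move=> v; rewrite mem_seq1 => /eqP->.
  by constructor 3; exists u.
have MD : forall R s, has_fact D R s -> has_fact M R s by apply/has_fact_subP.
have FPi : List.Forall (rule_holds F) (rules type_program).
  apply/type_rulesP => R s ER /DF-/(_ ER) DR.
  have Ds u : u \in s -> u \in adom D by move=> su; apply/adomP; exists R, s.
  split.
  - move=> u su; have du := has_fact_dom (MD _ _ DR) su.
    have [i ui] := m_rep (x := (M, u)) (conj MO du).
    by exists i; apply/F_type; split=> //; apply: Ds.
  (* No clash rule fires: facts of [D] hold in [M], and facts of [M] are allowed by the types of
     their constants. *)
  - move=> t szt Ft; apply: (fact_allowed _ (binE ER) (MD _ _ DR) szt).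
      by move=> A RE; apply: E_cl; rewrite RE.
    by move=> k ks i; have /F_type[] := Ft k i ks.
  move=> u i su iA /F_type[Du ui]; apply/F_goal; split=> //.
  exact/(ui (CName A0) A0_cl).
(* [F] lives over [E] and all fresh names, whereas [cert] expects an instance over the schema of the
   program. *)
have := rules_restrict FPi; rewrite edb_type_program => F'Pi.
suff /cert/(_ F'Pi)/restrictP[_ /F_goal[]//] :
  D `<=` restrict (idb type_program `|` E) F by [].
apply/has_fact_subP => R s DR; apply/restrictP; split; last exact: FD.
by rewrite in_fsetU (has_fact_over DR) orbT.
Qed.

End TypeProgram.
End Types.

(** * Assembling the translation of an ontology-mediated query *)

Lemma ALC_inclusions (O : ontology) : is_ontology ALC O ->
  exists incs, O = [seq inclusion p.1 p.2 | p <- incs].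
Proof.
elim=> [|_ {}O [C [D ->]] _ [incs ->]]; first by exists [::].
by exists ((C, D) :: incs).
Qed.

Lemma satisfies_inclusions S (M : structure S) incs :
  satisfies M [seq inclusion p.1 p.2 | p <- incs] <->
  forall p, List.In p incs ->
    forall c, c \in dom M -> csat M p.1 c -> csat M p.2 c.
Proof.
rewrite /satisfies; elim: incs => [|p incs IH] /=; first by split=> // _; constructor.
rewrite List.Forall_cons_iff IH holds_inclusion.
split=> [[Mp Mincs] p' [<-//|]|Mincs]; first exact: Mincs.
by split=> [|p' incp']; apply: Mincs; [left|right].
Qed.

Lemma AQ_inv S n (q : query S n) : AQ q ->
  n = 1 /\ exists2 A, concept_sym A \in S &
    forall (D : instance S) a, q D a <-> has_fact D (concept_sym A) a.
Proof. by case=> T A TA; split=> //; exists A => // D a; rewrite -mkfact_in. Qed.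

Lemma incl_flatten_map (T U : Type) (f : T -> seq U) x s :
  List.In x s -> List.incl (f x) (flatten (map f s)).
Proof.
elim: s => //= y s IHs [->|/IHs sx] u fu; first exact: In_catl.
exact/In_catr/sx.
Qed.

Lemma ALC_AQ_to_MDDlog : at_least_as_expressive_over binary UCS_MDDlog (OMQ ALC AQ).
Proof.
move=> S0 n0 q0 + OMQq; case: OMQq => {S0 n0 q0} S O n q ALCO /AQ_inv[n1 [A SA qE]] binS.
subst n; have [incs OE] := ALC_inclusions ALCO.
(* Subconcepts of the ontology are needed for the truth lemma, names of the data schema to respect
   the unary facts of the data, and [A] to read off the answer from a type. *)
pose cl := flatten [seq subconcepts p.1 ++ subconcepts p.2 | p <- incs]
  ++ [seq CName R.1 | R <- concept_sym A :: S].
have incs_cl p : List.In p incs ->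
    List.incl (subconcepts p.1) cl /\ List.incl (subconcepts p.2) cl.
  move=> /(incl_flatten_map (f := fun p => subconcepts p.1 ++ subconcepts p.2)) incp.
  by split=> C pC; apply/In_catl/incp; [apply: In_catl|apply: In_catr].
have name_cl B : concept_sym B \in concept_sym A :: S -> List.In (CName B) cl.
  move=> SB; apply/In_catr.
  exact: (In_map (fun R : relsym => CName R.1) (in_List SB)).
have satO (M : structure (S `|` sig O)) := satisfies_inclusions M incs.
rewrite -OE in satO.
have [I [m [m_pm m_rep]]] := finite_representatives
  (fun (x : structure (S `|` sig O) * const) C => csat x.1 C x.2)
  (@is_pmodel _ O) cl.
have E_cl B : concept_sym B \in S -> List.In (CName B) cl.
  by move=> SB; apply: name_cl; rewrite inE SB orbT.
have E_sub R : R \in S -> R \in S `|` sig O by rewrite in_fsetU => ->.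
apply: (UCS_MDDlog_intro (Pi := type_program cl m S A)) => //.
- exact: (edb_type_program _ _ _ binS).
- exact: (type_program_UCS _ _ _ binS).
move=> D a; have [c aE] : exists c, tval a = [:: c].
  by have := size_tuple a; case: (tval a) => [|c []] // _; exists c.
have c_ans M : q M a <-> has_fact M (concept_sym A) [:: c] by rewrite qE aE.
split=> -[sub_a ans]; split=> //.
  move=> D' DD' D'Pi; rewrite aE.
  apply: (type_program_sound satO incs_cl m_pm m_rep E_sub _ DD' D'Pi).
    by apply: sub_a; rewrite memtE aE mem_head.
  by move=> M MO DM; apply/c_ans/ans.
move=> M MO DM; apply/c_ans.
apply: (type_program_complete m_rep binS E_cl _ MO DM).
  by apply: name_cl; rewrite mem_head.
by move=> D' DD' D'Pi; have := ans D' DD' D'Pi; rewrite aE.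
Qed.

Theorem theorem2 : same_expressive_power_over binary (OMQ ALC AQ) UCS_MDDlog.
Proof. by split; [apply: MDDlog_to_ALC_AQ|apply: ALC_AQ_to_MDDlog]. Qed.
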